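(* Let $(\Omega,\mathcal{F})$ be a measurable space, $T:\Omega\to\Omega$ measurable, and $V$ a $T$-invariant upper probability. The following are equivalent: (i) $V$ is ergodic; (ii) there exists $Q\in\operatorname{core}(V)\cap\mathcal{M}^e(T)$ such that $V(A)=Q(A)$ for all $A\in\mathcal{I}$, and $\lim_{n\to\infty}\int\frac{1}{n}\sum_{i=0}^{n-1}f\cdot(g\circ T^i)\,dV=\left(\int f\,dV\right)\left(\int g\,dQ\right)$ for all bounded $\mathcal{F}$-measurable $f,g$ with $g\ge0$; (iii) there exists $Q\in\operatorname{core}(V)\cap\mathcal{M}(T)$ such that $\lim_{n\to\infty}\int\frac{1}{n}\sum_{i=0}^{n-1}1_B\cdot(1_C\circ T^i)\,dV=V(B)Q(C)$ for all $B,C\in\mathcal{F}$; (iv) there exists a probability $Q$ on $(\Omega,\mathcal{F})$ such that for every $A\in\mathcal{I}$, $Q(A)=0$ implies $V(A)=0$, and $\liminf_{n\to\infty}\int\frac{1}{n}\sum_{i=0}^{n-1}1_B\cdot(1_C\circ T^i)\,dV\ge V(B)Q(C)$ for all $B,C\in\mathcal{F}$.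
   Context: A capacity is a monotone map $\mu:\mathcal{F}\to[0,1]$ with $\mu(\emptyset)=0,\mu(\Omega)=1$. An upper probability is a capacity $V$ with $V(A)=\max_{P\in\Lambda}P(A)$ for a weak* (setwise convergence) compact set $\Lambda$ of probabilities; $\operatorname{core}(V)$ is the set of finitely additive normalized $P\le V$. $V$ is $T$-invariant if $V(T^{-1}A)=V(A)$; $\mathcal{I}=\{A\in\mathcal{F}:T^{-1}A=A\}$; $V$ is ergodic if for each $B\in\mathcal{I}$, $V(B)\in\{0,1\}$ and ($V(B)=0$ or $V(B^c)=0$). $\mathcal{M}(T)$: $T$-invariant probabilities; $\mathcal{M}^e(T)$: those with $P(\mathcal{I})\subset\{0,1\}$. Integrals with respect to $V$ are Choquet integrals $\int f\,dV=\int_0^\infty V(\{f\ge t\})dt+\int_{-\infty}^0(V(\{f\ge t\})-1)dt$. *)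

(* Defs.v *)
From HB Require Import structures.
From mathcomp Require Import all_boot all_order all_algebra.
From mathcomp Require Import all_classical all_reals all_analysis.

Set Implicit Arguments.
Unset Strict Implicit.
Unset Printing Implicit Defensive.

Import Order.TTheory GRing.Theory Num.Theory.
Import numFieldNormedType.Exports.

Local Open Scope classical_set_scope.
Local Open Scope ring_scope.

Section UpperProb.
Context {d : measure_display} {X : measurableType d} {R : realType}.

Definition msets := {A : set X | measurable A}.

(** a probability viewed as a point of the space of set functions on F with
    the topology of setwise convergence (pointwise convergence on F) *)
Definition setwise (P : probability X R) : {ptws msets -> \bar R} :=
  fun A => P (sval A).

Definition capacity (mu : set X -> R) :=
  [/\ mu set0 = 0, mu setT = 1,
      (forall A, measurable A -> 0 <= mu A <= 1) &
      (forall A B, measurable A -> measurable B -> A `<=` B -> mu A <= mu B)].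

Definition upper_probability (V : set X -> R) :=
  capacity V /\
  exists Lambda : set (probability X R),
    compact (setwise @` Lambda) /\
    forall A, measurable A ->
      (exists2 P, Lambda P & P A = (V A)%:E) /\
      (forall P, Lambda P -> P A <= (V A)%:E)%E.

(** core(V) restricted to (countably additive) probabilities *)
Definition in_core (V : set X -> R) (Q : probability X R) :=
  forall A, measurable A -> (Q A <= (V A)%:E)%E.

Variable T : X -> X.

Definition invariant_set (A : set X) := measurable A /\ T @^-1` A = A.

Definition T_invariant_cap (V : set X -> R) :=
  forall A, measurable A -> V (T @^-1` A) = V A.

Definition ergodic_cap (V : set X -> R) :=
  forall B, invariant_set B ->
    (V B = 0 \/ V B = 1) /\ (V B = 0 \/ V (~` B) = 0).

Definition invariant_prob (Q : probability X R) :=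
  forall A, measurable A -> Q (T @^-1` A) = Q A.

Definition ergodic_prob (Q : probability X R) :=
  invariant_prob Q /\
  forall A, invariant_set A -> Q A = 0%E \/ Q A = 1%E.

Definition avg (f g : X -> R) (n : nat) : X -> R :=
  fun x => n%:R^-1 * \sum_(i < n) f x * g (iter i T x).

End UpperProb.

Section Choquet.
Context {d : measure_display} {X : measurableType d} {R : realType}.

Definition choquet (V : set X -> R) (f : X -> R) : \bar R :=
  (\int[@lebesgue_measure R]_(t in `[0%R, +oo[) (V [set x | t <= f x])%:E +
   \int[@lebesgue_measure R]_(t in `]-oo, 0%R[) (V [set x | t <= f x] - 1)%:E)%E.

Definition bounded_measurable (f : X -> R) :=
  measurable_fun setT f /\ exists M : R, forall x, `|f x| <= M.

End Choquet.

(* Main.v *)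
Require Import Defs.
From HB Require Import structures.
From mathcomp Require Import all_boot all_order all_algebra.
From mathcomp Require Import all_classical all_reals all_analysis.
From mathcomp Require Import measurable_realfun lra zify.

Import Order.TTheory GRing.Theory Num.Theory.
Import numFieldNormedType.Exports.

Local Open Scope classical_set_scope.
Local Open Scope ring_scope.

(** The set [Lambda] being setwise compact, [V] is continuous along sequences
    decreasing to the empty set; hence every finitely additive [q <= V] is
    countably additive, and Choquet integrals converge under bounded convergence
    off a [V]-null set.

    If [V] is ergodic, an ultrafilter limit of the Cesaro averages of
    [P o T^-i], for some [P <= V], is an invariant probability [Q <= V]; it
    agrees with [V] on invariant sets because [V A] is 0 or [V (~` A)] is 0.
    Birkhoff's theorem for [Q] then holds off an invariant [Q]-null set, which is
    therefore [V]-null, and the bounded convergence theorem gives (ii).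
    Conversely, taking for [B] and [C] an invariant set and itself, or its
    complement, makes the averages constant, which gives (iii) => (iv) => (i). *)

Set Implicit Arguments.
Unset Strict Implicit.

(** * Upper probabilities *)

Section UpperProbability.
Context {d : measure_display} {X : measurableType d} {R : realType}.
Context {V : set X -> R} (hV : upper_probability V).

Lemma upper_probability_setT : V setT = 1.
Proof. by case: hV => -[]. Qed.

Lemma upper_probability_set0 : V set0 = 0.
Proof. by case: hV => -[]. Qed.

Lemma upper_probability_le (A B : set X) :
  measurable A -> measurable B -> A `<=` B -> V A <= V B.
Proof. by case: hV => -[_ _ _ h] _; exact: h. Qed.

Lemma upper_probability_ge0 (A : set X) : measurable A -> 0 <= V A.
Proof. by case: hV => -[_ _ h _] _ /h /andP[]. Qed.

Lemma upper_probability_le1 (A : set X) : measurable A -> V A <= 1.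
Proof. by case: hV => -[_ _ h _] _ /h /andP[]. Qed.

(** A single [P] attaining [V] at the union is subadditive and lies below [V] on each piece. *)
Lemma upper_probability_setU (A B : set X) :
  measurable A -> measurable B -> V (A `|` B) <= V A + V B.
Proof.
move=> mA mB; have [_ [L [_ hL]]] := hV.
have [[P LP PE] _] := hL _ (measurableU _ _ mA mB).
rewrite -lee_fin -PE EFinD (le_trans (measureU2 _ mA mB))// leeD//.
- by have [_] := hL _ mA; apply.
- by have [_] := hL _ mB; apply.
Qed.

(* The maximizers P_n of V (A n) have a setwise cluster point P in the compact
   set; as P_n (A m) >= V (A n) >= e for n >= m, also P (A m) >= e for all m,
   against the countable additivity of P. *)
Lemma upper_probability_cvg0 (A : (set X)^nat) :
  (forall n, measurable (A n)) ->
  (forall m n, (m <= n)%N -> A n `<=` A m) ->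
  \bigcap_n A n = set0 -> V (A n) @[n --> \oo] --> (0 : R).
Proof.
move=> mA ndA A0; have [_ [L [cL hL]]] := hV.
apply/cvgrPdist_lt => e e0; apply: contrapT => hn.
have Vge n : e <= V (A n).
  rewrite leNgt; apply/negP => Vn; apply: hn; exists n => // m /= nm.
  rewrite sub0r normrN ger0_norm ?upper_probability_ge0//.
  by apply: le_lt_trans Vn; apply: upper_probability_le => //; exact: ndA.
have /choice[P hP] n : exists P, L P /\ P (A n) = (V (A n))%:E.
  by have [[P LP PE] _] := hL _ (mA n); exists P.
pose F : set_system {ptws (@msets d X) -> \bar R} := (fun n => setwise (P n)) @ \oo.
have FL : F (setwise @` L) by exists 0%N => // n _; exists (P n) => //; case: (hP n).
have [_ [[P0 LP0 <-] cl]] := cL F _ FL.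
have Pge m : (e%:E <= P0 (A m))%E.
  rewrite leNgt; apply/negP => Plt.
  pose a : @msets d X := exist _ (A m) (mA m).
  (* Evaluation at [A m] is a coordinate projection, so being below [e] at [a] is an open condition;
     the tail of [F] violates it. *)
  have W : nbhs (setwise P0) [set g : {ptws (@msets d X) -> \bar R} | (g a < e%:E)%E].
    have pc := @proj_continuous {classic (@msets d X)} (fun=> \bar R) a (setwise P0).
    apply: (pc [set y | (y < e%:E)%E]); apply: open_nbhs_nbhs; split => //.
    exact: open_ereal_lt_ereal.
  have FW : F [set g | (e%:E <= g a)%E].
    exists m => // n /= mn; rewrite /setwise /=.
    apply: (@le_trans _ _ (P n (A n))); first by rewrite (hP n).2 lee_fin.
    by apply: le_measure; rewrite ?inE//; exact: ndA.
  have [g [/= h1 h2]] := cl _ _ FW W.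
  by move: (le_lt_trans h1 h2); rewrite ltxx.
have : P0 (A n) @[n --> \oo] --> P0 (\bigcap_n A n).
  apply: nonincreasing_cvg_mu => //.
  - by rewrite (le_lt_trans (probability_le1 _ _))// ltry.
  - by apply: bigcap_measurable => //; exists 0%N.
  - by move=> m n mn; apply/subsetPset; exact: ndA.
rewrite A0 measure0 => P0cvg.
have : (e%:E <= 0)%E.
  by apply: (cvge_to_ge P0cvg); exact: nearW.
by rewrite lee_fin leNgt e0.
Qed.

End UpperProbability.

(** * Monotone functions and scaling of the Lebesgue measure *)

Section RealLine.
Context {R : realType}.

(** The line is exhausted by the intervals []-n, n[]. One-sided limits of a monotone [F] exist and
    bracket [F t], so a point where they agree is a continuity point. *)
Lemma nondecreasing_discontinuity_countable (F : R -> R) :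
  {homo F : x y / x <= y} ->
  countable [set t | ~ (F x @[x --> t] --> F t)].
Proof.
move=> ndF.
have sub : [set t | ~ (F x @[x --> t] --> F t)] `<=` \bigcup_n
    [set x | x \in (`](- n%:R), n%:R[) /\ discontinuity F x].
  move=> t /= nc; exists (Num.bound `|t|) => //=; split.
    by rewrite in_itv/= -ltr_norml archi_boundP.
  have cl : cvg (F x @[x --> t^'-]).
    apply: nondecreasing_at_left_is_cvgr; apply: nearW => y.
      by move=> ? ? _ _; exact: ndF.
    by exists (F t) => _ [z /= + <-]; rewrite in_itv/= => /andP[_ /ltW/ndF].
  have cr : cvg (F x @[x --> t^'+]).
    apply: nondecreasing_at_right_is_cvgr; apply: nearW => y.
      by move=> ? ? _ _; exact: ndF.
    by exists (F t) => _ [z /= + <-]; rewrite in_itv/= => /andP[/ltW/ndF].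
  split => //; apply/eqP => lr; apply: nc; apply/left_right_continuousP.
  have hl : lim (F x @[x --> t^'-]) <= F t.
    apply: limr_le => //; near=> x; apply: ndF.
    by near: x; exact: nbhs_left_le.
  have hr : F t <= lim (F x @[x --> t^'+]).
    apply: limr_ge => //; near=> x; apply: ndF.
    by near: x; exact: nbhs_right_ge.
  have El : lim (F x @[x --> t^'-]) = F t by apply/eqP; rewrite eq_le hl lr hr.
  by split; [rewrite -[X in _ --> X]El | rewrite -[X in _ --> X]El lr].
apply: sub_countable (subset_card_le sub) _.
apply: bigcup_countable => // n _.
by apply: discontinuity_countable => ? ? _ _; exact: ndF.
Unshelve. all: end_near. Qed.

Lemma nonincreasing_continuous_ae (F : R -> R) :
  {homo F : x y /~ x <= y} ->
  {ae @lebesgue_measure R, forall t, F x @[x --> t] --> F t}.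
Proof.
move=> niF; have ndG : {homo (fun x => - F x) : x y / x <= y}.
  by move=> x y xy; rewrite lerN2 niF.
have cG := nondecreasing_discontinuity_countable ndG.
exists [set t | ~ (- F x @[x --> t] --> - F t)]; split.
- by apply: countable_measurable cG => x; exact: measurable_set1.
- exact: countable_lebesgue_measure0.
- move=> t /= nF cF; apply: nF => /=.
  rewrite -[X in _ --> X]opprK; apply: cvg_trans (cvgN cF).
  by apply: near_eq_cvg; apply: nearW => x /=; rewrite opprK.
Unshelve. all: end_near. Qed.

(** The left side, as a function of [A], is a scaled pushforward measure that gives half-open
    intervals their length; uniqueness of the Lebesgue measure concludes. *)
Lemma lebesgue_measure_scale (c : R) (A : set R) : 0 < c -> measurable A ->
  (c%:E * lebesgue_measure ( *%R c @^-1` A))%E = lebesgue_measure A.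
Proof.
move=> c0 mA.
pose phi : measurableTypeR R -> measurableTypeR R := *%R c.
have mphi : measurable_fun setT phi by exact: mulrl_measurable.
pose m : {measure set (measurableTypeR R) -> \bar R} :=
  mscale (NngNum (ltW c0))
    (measure_function_pushforward__canonical__measure_function_Measure
      (@lebesgue_measure R) mphi).
have -> : (c%:E * lebesgue_measure ( *%R c @^-1` A))%E = m A by [].
apply/esym/lebesgue_measure_unique => // _ [[a b] /= _ <-].
rewrite /m /mscale /= /pushforward /phi.
have E1 : *%R c @^-1` `]a, b]%classic = `](c^-1 * a), (c^-1 * b)]%classic.
  by apply/seteqP; split => x /=; rewrite !in_itv/= ltr_pdivrMl// ler_pdivlMl.
rewrite E1 !lebesgue_measure_itv/= !lte_fin ltr_pM2l ?invr_gt0//.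
case: ifPn => _; last by rewrite mule0.
by rewrite -!EFinD -EFinM -mulrBr mulVKf ?gt_eqF.
Qed.

Lemma ge0_integral_scale (c : R) (D : set R) (f : R -> \bar R) :
  0 < c -> measurable D -> measurable_fun D f -> (forall x, D x -> 0 <= f x)%E ->
  (\int[lebesgue_measure]_(x in D) f x =
   c%:E * \int[lebesgue_measure]_(x in *%R c @^-1` D) f (c * x)%R)%E.
Proof.
move=> c0 mD mf f0.
pose phi : measurableTypeR R -> measurableTypeR R := *%R c.
have mphi : measurable_fun setT phi by exact: mulrl_measurable.
have := @ge0_integral_pushforward _ _ _ _ R phi mphi lebesgue_measure D f mD mf.
rewrite /phi /= => <-; last by move=> y /set_mem; exact: f0.
pose k : {nonneg R} := NngNum (ltW c0).
pose m := measure_function_pushforward__canonical__measure_function_Measure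
  (@lebesgue_measure R) mphi.
transitivity (\int[mscale k m]_(x in D) f x)%E; last exact: ge0_integral_mscale.
apply: eq_measure_integral => A mA _.
exact: (esym (lebesgue_measure_scale c0 mA)).
Qed.

End RealLine.

(** * The Choquet integral *)

Section ChoquetTheory.
Context {d : measure_display} {X : measurableType d} {R : realType}.
Context {V : set X -> R} (hV : upper_probability V).

Lemma measurable_superlevel (f : X -> R) (t : R) :
  measurable_fun setT f -> measurable [set x | t <= f x].
Proof.
by move=> mf; rewrite -[X in measurable X]setTI -preimage_itvcy; exact: mf.
Qed.

Lemma superlevel_nonincreasing (f : X -> R) : measurable_fun setT f ->
  {homo (fun t => V [set x | t <= f x]) : s t /~ s <= t}.
Proof.
move=> mf s t st; apply: upper_probability_le => //; try exact: measurable_superlevel.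
by move=> x /=; exact: le_trans.
Qed.

Lemma measurable_superlevel_fun (D : set R) (f : X -> R) : measurable D ->
  measurable_fun setT f -> measurable_fun D (fun t => V [set x | t <= f x]).
Proof.
move=> mD mf; apply: nonincreasing_measurable => //.
by move=> s t; exact: superlevel_nonincreasing.
Qed.

Lemma superlevel_gt (f : X -> R) (K t : R) : (forall x, `|f x| <= K) ->
  K < t -> V [set x | t <= f x] = 0.
Proof.
move=> fK Kt; rewrite (_ : [set x | _] = set0) ?(upper_probability_set0 hV)//.
apply/seteqP; split => // x /= tf; have := le_lt_trans (fK x) Kt.
by rewrite ltNge (le_trans tf)// ler_norm.
Qed.

Lemma superlevel_le (f : X -> R) (K t : R) : (forall x, `|f x| <= K) ->
  t <= - K -> V [set x | t <= f x] = 1.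
Proof.
move=> fK Kt; rewrite (_ : [set x | _] = setT) ?(upper_probability_setT hV)//.
apply/seteqP; split => // x _ /=; apply: le_trans Kt _.
by have := fK x; rewrite ler_norml => /andP[].
Qed.

Lemma superlevel_bounds (f : X -> R) (t : R) : measurable_fun setT f ->
  0 <= V [set x | t <= f x] <= 1.
Proof.
move=> mf; have mt := measurable_superlevel t mf.
by rewrite upper_probability_ge0// upper_probability_le1.
Qed.

Lemma integrable_indic_segment (D : set R) (K : R) : measurable D ->
  (@lebesgue_measure R).-integrable D (fun t => (\1_(`[- K, K]) t)%:E).
Proof.
move=> mD; apply: (integrableS measurableT) => //.
exact: integrable_indic_itv.
Qed.

(** Here and in the companion for [t <= 0], the majorant depends on [f] only through [K], which
    makes it usable for dominated convergence along a uniformly bounded sequence. *)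
Lemma superlevel_dominated (f : X -> R) (K t : R) : measurable_fun setT f ->
  (forall x, `|f x| <= K) -> 0 <= t ->
  `|V [set x | t <= f x]| <= \1_(`[- K, K]) t :> R.
Proof.
move=> mf fK t0; have /andP[V0 V1] := superlevel_bounds t mf.
have [Kt|tK] := ltP K t; first by rewrite (superlevel_gt fK Kt) normr0.
by rewrite ger0_norm// indicE mem_set//= in_itv/= tK andbT; lra.
Qed.

Lemma superlevel_sub1_dominated (f : X -> R) (K t : R) : measurable_fun setT f ->
  (forall x, `|f x| <= K) -> t <= 0 ->
  `|V [set x | t <= f x] - 1| <= \1_(`[- K, K]) t :> R.
Proof.
move=> mf fK t0; have /andP[V0 V1] := superlevel_bounds t mf.
have [Kt|tK] := leP t (- K); first by rewrite (superlevel_le fK Kt) subrr normr0.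
rewrite ler0_norm ?subr_le0// indicE mem_set//=; first lra.
by rewrite in_itv/=; lra.
Qed.

(* Convergence off a null set gives convergence in capacity, because V is
   continuous along sequences decreasing to the empty set. *)
Lemma cvg_in_capacity (f_ : nat -> X -> R) (f : X -> R) (N : set X) (e : R) :
  (forall n, measurable_fun setT (f_ n)) -> measurable_fun setT f ->
  measurable N -> V N = 0 ->
  (forall x, ~ N x -> f_ n x @[n --> \oo] --> f x) -> 0 < e ->
  V [set x | e <= `|f_ n x - f x|] @[n --> \oo] --> (0 : R).
Proof.
move=> mf_ mf mN N0 cf e0.
pose E n := [set x | e <= `|f_ n x - f x|].
have mE n : measurable (E n).
  by apply: measurable_superlevel; apply: measurableT_comp => //; exact: measurable_funB.
pose B n := (\bigcup_(m in [set m | (n <= m)%N]) E m) `\` N.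
have mB n : measurable (B n).
  by apply: measurableD => //; apply: bigcup_measurable => m _.
have VB : V (B n) @[n --> \oo] --> (0 : R).
  apply: (upper_probability_cvg0 hV) => //.
    by move=> m n mn x [[k /= nk Ek] Nx]; split => //; exists k => //=; exact: leq_trans nk.
  apply/seteqP; split => // x Bx; have [_ Nx] := Bx 0%N I.
  have /cvgrPdist_lt /(_ _ e0) [n _ hn] := cf x Nx.
  have [[m /= nm Em] _] := Bx n I; have /= := hn m nm.
  by rewrite distrC ltNge Em.
apply: (@squeeze_cvgr _ _ _ _ (cst 0) (fun n => V (B n))) => //; last exact: cvg_cst.
apply: nearW => n; rewrite (upper_probability_ge0 hV (mE n))/=.
rewrite -[V (B n)]addr0 -N0.
apply: le_trans (upper_probability_setU hV (mB n) mN).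
apply: upper_probability_le; [by []|exact: mE|exact: measurableU|].
move=> x Ex; have [Nx|Nx] := pselect (N x); [by right|left; split => //].
by exists n => /=.
Qed.

(** Outside the set where [f_ n] and [f] differ by at least [s], the level set of [f_ n] at [t] lies
    between those of [f] at [t + s] and [t - s]. Subadditivity and continuity of the level function
    at [t] then squeeze. *)
Lemma superlevel_cvg (f_ : nat -> X -> R) (f : X -> R) (N : set X) (t : R) :
  (forall n, measurable_fun setT (f_ n)) -> measurable_fun setT f ->
  measurable N -> V N = 0 ->
  (forall x, ~ N x -> f_ n x @[n --> \oo] --> f x) ->
  V [set x | s <= f x] @[s --> t] --> V [set x | t <= f x] ->
  V [set x | t <= f_ n x] @[n --> \oo] --> V [set x | t <= f x].
Proof.
move=> mf_ mf mN N0 cf ct; apply/cvgrPdist_lt => e e0.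
have e20 : 0 < e / 2 by rewrite divr_gt0.
have /cvgrPdist_lt /(_ _ e20) [r /= r0 hr] := ct.
(* Half the radius keeps [t - s] and [t + s] strictly inside the ball given by continuity at [t]. *)
pose s := r / 2; have s0 : 0 < s by rewrite divr_gt0.
have /(cvgrPdist_lt) /(_ _ e20) := cvg_in_capacity mf_ mf mN N0 cf s0.
apply: filterS => n /=.
set W := V _; set F := fun s => V [set x | s <= f x].
have mW : measurable [set x | s <= `|f_ n x - f x|].
  by apply: measurable_superlevel; apply: measurableT_comp => //; exact: measurable_funB.
have W0 : 0 <= W by exact: upper_probability_ge0.
rewrite sub0r normrN ger0_norm// => We.
have h1 : F (t + s) <= V [set x | t <= f_ n x] + W.
  apply: le_trans (upper_probability_setU hV (measurable_superlevel t (mf_ n)) mW).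
  apply: upper_probability_le => //; first exact: measurable_superlevel.
    by apply: measurableU => //; exact: measurable_superlevel.
  move=> x /= tf; have [h|h] := leP s `|f_ n x - f x|; [by right|left => /=].
  by move: h; rewrite ltr_norml; lra.
have h2 : V [set x | t <= f_ n x] <= F (t - s) + W.
  apply: le_trans (upper_probability_setU hV (measurable_superlevel (t - s) mf) mW).
  apply: upper_probability_le => //; first exact: measurable_superlevel.
    by apply: measurableU => //; exact: measurable_superlevel.
  move=> x /= tf; have [h|h] := leP s `|f_ n x - f x|; [by right|left => /=].
  by move: h; rewrite ltr_norml; lra.
have sr : s < r by rewrite /s; lra.
have := hr (t + s); have := hr (t - s); rewrite /ball_/= -/(F t) -/(F (t+s)) -/(F (t-s)).
have -> : t - (t - s) = s by lra.
have -> : t - (t + s) = - s by lra.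
rewrite normrN gtr0_norm// => /(_ sr) + /(_ sr).
rewrite !ltr_norml; lra.
Qed.

Lemma superlevel_sub1_integrable (f : X -> R) (K : R) : measurable_fun setT f ->
  (forall x, `|f x| <= K) ->
  (@lebesgue_measure R).-integrable `]-oo, 0%R[ (fun t => (V [set x | t <= f x] - 1)%:E).
Proof.
move=> mf fK; apply: le_integrable (integrable_indic_segment K _) => //.
  apply/measurable_EFinP; apply: measurable_funB => //.
  exact: measurable_superlevel_fun.
move=> t /=; rewrite in_itv/= => /ltW t0; rewrite lee_fin.
by apply: le_trans (superlevel_sub1_dominated mf fK t0) _; rewrite ler_norm.
Qed.

(** Dominated convergence in [t] on each half-line: the level functions converge wherever the
    monotone level function of [f] is continuous, hence almost everywhere. *)
Lemma choquet_cvg (f_ : nat -> X -> R) (f : X -> R) (N : set X) (K : R) :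
  (forall n, measurable_fun setT (f_ n)) -> measurable_fun setT f ->
  (forall n x, `|f_ n x| <= K) -> (forall x, `|f x| <= K) ->
  measurable N -> V N = 0 ->
  (forall x, ~ N x -> f_ n x @[n --> \oo] --> f x) ->
  choquet V (f_ n) @[n --> \oo] --> choquet V f.
Proof.
move=> mf_ mf fK_ fK mN N0 cf.
have [A [mA A0 sA]] := nonincreasing_continuous_ae (superlevel_nonincreasing mf).
apply: cvgeD.
- apply/fin_num_adde_defl/integrable_fin_num => //.
  exact: superlevel_sub1_integrable fK.
- have [|||||_ _] := @dominated_convergence _ _ _ (@lebesgue_measure R)
      `[0%R, +oo[ (measurable_itv _) (fun n t => (V [set x | t <= f_ n x])%:E)
      (fun t => (V [set x | t <= f x])%:E) (fun t => (\1_(`[- K, K]) t)%:E).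
  + by move=> n; apply/measurable_EFinP; exact: measurable_superlevel_fun.
  + by apply/measurable_EFinP; exact: measurable_superlevel_fun.
  + exists A; split => // t /= h; apply: sA => /= ct; apply: h => _.
    apply: cvg_EFin; first exact: nearW.
    exact: (superlevel_cvg mf_ mf mN N0 cf ct).
  + exact: integrable_indic_segment.
  + apply: aeW => t n /=; rewrite in_itv/= andbT lee_fin; exact: superlevel_dominated.
  + exact.
- have [|||||_ _] := @dominated_convergence _ _ _ (@lebesgue_measure R)
      `]-oo, 0%R[ (measurable_itv _) (fun n t => (V [set x | t <= f_ n x] - 1)%:E)
      (fun t => (V [set x | t <= f x] - 1)%:E) (fun t => (\1_(`[- K, K]) t)%:E).
  + move=> n; apply/measurable_EFinP/measurable_funB => //.
    exact: measurable_superlevel_fun.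
  + by apply/measurable_EFinP/measurable_funB => //; exact: measurable_superlevel_fun.
  + exists A; split => // t /= h; apply: sA => /= ct; apply: h => _.
    apply: cvg_EFin; first exact: nearW.
    apply: cvgB; last exact: cvg_cst.
    exact: (superlevel_cvg mf_ mf mN N0 cf ct).
  + exact: integrable_indic_segment.
  + apply: aeW => t n /=; rewrite in_itv/= lee_fin => /ltW; exact: superlevel_sub1_dominated.
  + exact.
Qed.

Lemma choquet_indic (B : set X) : measurable B -> choquet V (\1_B) = (V B)%:E.
Proof.
move=> mB; rewrite /choquet.
rewrite [X in (_ + X)%E]integral0_eq ?adde0; last first.
  move=> t /=; rewrite in_itv/= => t0; rewrite (_ : [set x | _] = setT).
    by rewrite (upper_probability_setT hV) subrr.
  by apply/seteqP; split => // x _ /=; rewrite (le_trans (ltW t0)).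
(* The point [t = 0], where the level set is the whole space, is removed from the domain. *)
rewrite -integral_itv_obnd_cbnd; last first.
  by apply/measurable_EFinP; exact: measurable_superlevel_fun.
transitivity (\int[@lebesgue_measure R]_(t in `]0%R, +oo[)
    ((V B)%:E * (\1_(`]0%R, 1%R]) t)%:E))%E.
  apply: eq_integral => t /set_mem /=; rewrite in_itv/= andbT => t0.
  rewrite -EFinM; congr (_%:E); rewrite indicE; have [t1|t1] := leP t 1.
    rewrite mem_set/= ?in_itv/= ?t0//= mulr1; congr V; apply/seteqP; split => x /=.
      by rewrite indicE; case: (boolP (x \in B)) => [/set_mem//|_]; rewrite leNgt t0.
    by move=> Bx; rewrite indicE mem_set.
  rewrite memNset ?mulr0/=; last by rewrite in_itv/= leNgt t1 andbF.
  rewrite -(upper_probability_set0 hV); congr V; apply/seteqP; split => x //=.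
  by rewrite leNgt (le_lt_trans _ t1)// indicE; case: (_ \in _).
rewrite ge0_integralZl//=; last 2 first.
- exact/measurable_EFinP.
- by rewrite lee_fin upper_probability_ge0.
rewrite integral_indic//= setIidl; last by move=> x /=; rewrite !in_itv/= andbT => /andP[].
by rewrite lebesgue_measure_itv/= lte_fin ltr01 sube0 mule1.
Qed.

(** Substitution [t = c * s] in both integrals, since the level set of [f * c] at [c * s] is that of
    [f] at [s]. *)
Lemma choquetZ (f : X -> R) (c K : R) : measurable_fun setT f ->
  (forall x, `|f x| <= K) -> 0 <= c ->
  choquet V (fun x => f x * c) = (choquet V f * c%:E)%E.
Proof.
move=> mf fK; rewrite le_eqVlt => /predU1P[<-|c0].
  (* For [c = 0] the integrand is the indicator of the empty set. *)
  rewrite mule0; have := choquet_indic measurable0.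
  rewrite (upper_probability_set0 hV) => E0; rewrite -[RHS]E0; congr choquet; apply/funext => x.
  by rewrite mulr0 indic0.
have mcf : measurable_fun setT (fun x => f x * c) by exact: measurable_funM.
have lev t : [set x | c * t <= f x * c] = [set x | t <= f x].
  by apply/seteqP; split => x /=; rewrite mulrC ler_pM2r.
rewrite /choquet muleDl//; last first.
  apply/fin_num_adde_defl/integrable_fin_num => //.
  exact: superlevel_sub1_integrable fK.
congr (_ + _)%E.
  rewrite (ge0_integral_scale c0)//; last 2 first.
  - by apply/measurable_EFinP; exact: measurable_superlevel_fun.
  - by move=> t _; rewrite lee_fin; have /andP[] := superlevel_bounds t mcf.
  rewrite muleC; congr (_ * _)%E.
  have -> : *%R c @^-1` `[0%R, +oo[%classic = `[0%R, +oo[%classic.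
    by apply/seteqP; split => x /=; rewrite !in_itv/= !andbT pmulr_rge0.
  by apply: eq_integral => t _; rewrite lev.
(* The integrand on the negative half-line is nonpositive, so its sign is flipped before the change
   of variables for nonnegative functions. *)
have negE (g : X -> R) : measurable_fun setT g ->
    (\int[@lebesgue_measure R]_(t in `]-oo, 0%R[) (V [set x | t <= g x] - 1)%:E =
     - \int[@lebesgue_measure R]_(t in `]-oo, 0%R[) (1 - V [set x | t <= g x])%:E)%E.
  move=> mg; rewrite -integral_ge0N; last first.
    by move=> t _; rewrite lee_fin subr_ge0; have /andP[] := superlevel_bounds t mg.
  by apply: eq_integral => t _; rewrite -EFinN opprB.
rewrite !negE// mulNe; congr (- _)%E.
rewrite (ge0_integral_scale c0)//; last 2 first.
- by apply/measurable_EFinP/measurable_funB => //; exact: measurable_superlevel_fun.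
- by move=> t _; rewrite lee_fin subr_ge0; have /andP[] := superlevel_bounds t mcf.
rewrite muleC; congr (_ * _)%E.
have -> : *%R c @^-1` `]-oo, 0%R[%classic = `]-oo, 0%R[%classic.
  by apply/seteqP; split => x /=; rewrite !in_itv/= pmulr_rlt0.
by apply: eq_integral => t _; rewrite lev.
Qed.

End ChoquetTheory.

(** * Invariant probabilities in the core *)

(** Compactness of [[a, b]] gives a cluster point, and a cluster point of an ultrafilter is a
    limit. *)
Lemma ultrafilter_bounded_cvg {R : realType} {I : Type} (U : set_system I)
    (u : I -> R) (a b : R) : UltraFilter U -> (forall i, a <= u i <= b) ->
  cvg (u i @[i --> U]).
Proof.
move=> UU uab; have UF : (u @ U) `[a, b]%classic.
  by apply: (@filterS _ U _ setT) filterT => i _ /=; rewrite in_itv/=.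
have [l [_ cl]] := @segment_compact R a b (u @ U) _ UF.
apply/cvg_ex; exists l => W lW.
have [//|UW] := in_ultra_setVsetC (u @^-1` W) UU.
by have [y []] := cl (~` W) W UW lW.
Qed.

Lemma cvg_bounded_div {R : realType} (w : nat -> R) (K : R) :
  (forall n, `|w n| <= K) -> n%:R^-1 * w n @[n --> \oo] --> (0 : R).
Proof.
move=> wK; apply/cvgrPdist_lt => e e0.
have K0 : 0 <= K by exact: le_trans (wK 0%N).
exists (Num.bound (K / e)).+1 => // n /= Kn; have n0 : (0 < n)%N by lia.
rewrite sub0r normrN normrM normfV normr_nat ltr_pdivrMl ?ltr0n//.
rewrite (le_lt_trans (wK n))// mulrC -ltr_pdivrMl// mulrC.
apply: (lt_le_trans (archi_boundP (divr_ge0 K0 (ltW e0)))).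
by rewrite ler_nat ltnW.
Qed.

Section InvariantCore.
Context {d : measure_display} {X : measurableType d} {R : realType}.
Context {V : set X -> R} (hV : upper_probability V).

(* The tails of a disjoint union decrease to the empty set, where V vanishes. *)
Lemma core_sigma_additive (q : set X -> R) :
  (forall A, measurable A -> 0 <= q A <= V A) ->
  (forall A B, measurable A -> measurable B -> A `&` B = set0 ->
    q (A `|` B) = q A + q B) ->
  semi_sigma_additive (fun A => if `[< measurable A >] then (q A)%:E else 0%E).
Proof.
move=> q0V qD F mF tF mUF.
pose tail n := \bigcup_(i in [set i | (n <= i)%N]) F i.
have mtail n : measurable (tail n) by apply: bigcup_measurable.
have qE n : q (\bigcup_i F i) = \sum_(0 <= i < n) q (F i) + q (tail n).
  elim: n => [|n ->].
    rewrite big_geq// add0r /tail; congr q; apply/seteqP; split => x [i _ Fi]; by exists i.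
  rewrite big_nat_recr//= -addrA; congr (_ + _); rewrite -qD//.
    congr q; apply/seteqP; split => x.
      move=> [i /=]; rewrite leq_eqVlt => /predU1P[<-|ni] Fi; first by left.
      by right; exists i.
    by case=> [Fn|[i /= /ltnW ni Fi]]; [exists n => /=|exists i].
  apply/seteqP; split => // x [Fn [i /= ni Fi]].
  have /trivIsetP/(_ n i I I) := tF; rewrite ltn_eqF// => /(_ isT) E.
  by have : (F n `&` F i) x by []; rewrite E.
have qt : q (tail n) @[n --> \oo] --> (0 : R).
  apply: (@squeeze_cvgr _ _ _ _ (cst 0) (V \o tail)).
  - by apply: nearW => n; exact: q0V.
  - exact: cvg_cst.
  - apply: (upper_probability_cvg0 hV) => //.
      by move=> m n mn x [i /= ni Fi]; exists i => //=; exact: leq_trans ni.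
    apply/seteqP; split => // x tx; have [n _ Fn] := tx 0%N I.
    have [i /= ni Fi] := tx n.+1 I.
    have /trivIsetP/(_ n i I I) := tF; rewrite ltn_eqF// => /(_ isT) E.
    by have : (F n `&` F i) x by []; rewrite E.
rewrite asboolT//.
have -> : (fun n => \sum_(0 <= i < n)
      (if `[< measurable (F i) >] then (q (F i))%:E else 0))%E =
    (fun n => (q (\bigcup_i F i) - q (tail n))%:E).
  apply/funext => n; rewrite [in RHS](qE n) addrK.
  by rewrite -sumEFin; apply: eq_bigr => i _; rewrite asboolT.
apply: cvg_EFin; first exact: nearW.
by rewrite -[X in _ --> X]subr0; apply: cvgB => //; exact: cvg_cst.
Qed.

Context {T : X -> X} (mT : measurable_fun setT T) (hT : T_invariant_cap T V).

Lemma measurable_iter i : measurable_fun setT (iter i T).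
Proof.
elim: i => [|i IH]; first exact: measurable_id.
exact: (measurableT_comp mT IH).
Qed.

Lemma measurable_preimage_iter i A : measurable A -> measurable (iter i T @^-1` A).
Proof.
by move=> mA; rewrite -[X in measurable X]setTI; exact: measurable_iter.
Qed.

Lemma preimage_iterS i (A : set X) : iter i.+1 T @^-1` A = iter i T @^-1` (T @^-1` A).
Proof. by []. Qed.

Lemma upper_probability_iter i A : measurable A -> V (iter i T @^-1` A) = V A.
Proof.
elim: i A => [//|i IH] A mA; rewrite preimage_iterS IH ?hT//.
exact: (measurable_preimage_iter 1).
Qed.

(* Q is an ultrafilter limit of the Cesaro averages of the images of some
   P <= V under the iterates of T. *)
Lemma exists_invariant_core :
  exists Q : probability X R, in_core V Q /\ invariant_prob T Q.
Proof.
have [_ [L [_ hL]]] := hV.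
have [[P LP _] _] := hL _ measurableT.
pose p A := fine (P A).
have pV A : measurable A -> 0 <= p A <= V A.
  move=> mA; have Pf := fin_num_measure P _ mA.
  rewrite fine_ge0//= -lee_fin fineK//.
  by have [_] := hL _ mA; apply.
have pD A B : measurable A -> measurable B -> A `&` B = set0 -> p (A `|` B) = p A + p B.
  by move=> mA mB AB; rewrite /p measureU// fineD// fin_num_measure.
pose a A n : R := n%:R^-1 * \sum_(i < n) p (iter i T @^-1` A).
have aV A n : measurable A -> 0 <= a A n <= V A.
  move=> mA; have V0 := upper_probability_ge0 hV mA; rewrite /a; case: n => [|n].
    by rewrite big_ord0 mulr0 lexx.
  rewrite mulr_ge0 ?invr_ge0//=; last first.
    by apply: sumr_ge0 => i _; have /andP[] := pV _ (measurable_preimage_iter i mA).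
  rewrite ler_pdivrMl// mulr_natl.
  rewrite -[leRHS](_ : \sum_(i < n.+1) V A = _); last by rewrite sumr_const card_ord.
  apply: ler_sum => i _; rewrite -(upper_probability_iter i mA).
  by have /andP[] := pV _ (measurable_preimage_iter i mA).
(* One ultrafilter refining [\oo] yields limits for all measurable sets at once, where a subsequence
   would handle only countably many. *)
have [U [UU ooU]] := @ultraFilterLemma nat \oo _.
pose q A := lim (a A n @[n --> U]).
have cq A : measurable A -> a A n @[n --> U] --> q A.
  by move=> mA; apply: (ultrafilter_bounded_cvg (a := 0) (b := V A)) => n; exact: aV.
have qV A : measurable A -> 0 <= q A <= V A.
  move=> mA; apply/andP; split.
    by apply: limr_ge; [exact: cq|apply: nearW => n; have /andP[] := aV _ n mA].
  by apply: limr_le; [exact: cq|apply: nearW => n; have /andP[] := aV _ n mA].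
have qD A B : measurable A -> measurable B -> A `&` B = set0 -> q (A `|` B) = q A + q B.
  move=> mA mB AB; apply: cvg_lim => //.
  rewrite (_ : (fun n => _) = (fun n => a A n + a B n)); first by apply: cvgD; exact: cq.
  apply/funext => n; rewrite /a -mulrDr -big_split/=; congr (_ * _).
  apply: eq_bigr => i _; rewrite preimage_setU pD//; try exact: measurable_preimage_iter.
  by rewrite -preimage_setI AB preimage_set0.
have qT : q setT = 1.
  (* The average of the whole space is 1 only from [n = 1] on, the empty average at 0 being 0. *)
  apply: cvg_lim => //; apply: cvg_near_cst; apply: ooU; exists 1%N => // n /= n1.
  rewrite /a; under eq_bigr do rewrite preimage_setT /p probability_setT.
  by rewrite sumr_const card_ord -[X in _ * X]mulr_natl mulr1 mulVf// pnatr_eq0 -lt0n.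
have qI A : measurable A -> q (T @^-1` A) = q A.
  move=> mA; have mTA := measurable_preimage_iter 1 mA.
  suff h : a (T @^-1` A) n - a A n @[n --> U] --> (0 : R).
    apply/eqP; rewrite -subr_eq0; apply/eqP.
    have h' : a (T @^-1` A) n - a A n @[n --> U] --> q (T @^-1` A) - q A.
      by apply: cvgB; exact: cq.
    by rewrite -(cvg_lim (@Rhausdorff R) h'); exact: (cvg_lim (@Rhausdorff R) h).
  apply: (cvg_trans (cvg_app _ ooU)).
  (* The difference of the two averages telescopes to its end terms, which are bounded. *)
  have aE n : a (T @^-1` A) n - a A n = n%:R^-1 * (p (iter n T @^-1` A) - p A).
    rewrite /a -mulrBr; congr (_ * _).
    rewrite -(big_mkord xpredT (fun i => p (iter i T @^-1` (T @^-1` A)))).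
    rewrite -(big_mkord xpredT (fun i => p (iter i T @^-1` A))) -sumrB.
    under eq_bigr do rewrite -preimage_iterS.
    by rewrite (telescope_sumr (fun i => p (iter i T @^-1` A))).
  have -> : (fun n => a (T @^-1` A) n - a A n) =
      (fun n => n%:R^-1 * (p (iter n T @^-1` A) - p A)) by apply/funext.
  apply: (@cvg_bounded_div _ _ 1) => n.
  have h1 := pV _ (measurable_preimage_iter n mA); have h2 := pV _ mA.
  move: h1 h2; rewrite (upper_probability_iter n mA).
  by have := upper_probability_le1 hV mA; rewrite ler_norml; lra.
(* A measure must be nonnegative on every set, whereas [q] is controlled only on measurable ones; it
   is set to 0 elsewhere. *)
pose Qf A := if `[< measurable A >] then (q A)%:E else 0%E : \bar R.
have Q0 : Qf set0 = 0%E.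
  rewrite /Qf asboolT//; congr (_%:E); apply/eqP; rewrite eq_le.
  by rewrite andbC; move: (qV _ measurable0); rewrite (upper_probability_set0 hV).
have Qge A : (0 <= Qf A)%E.
  rewrite /Qf; case: asboolP => // mA; rewrite lee_fin.
  by have /andP[] := qV _ mA.
have Qs : semi_sigma_additive Qf by exact: core_sigma_additive.
have QT : Qf setT = 1%E by rewrite /Qf asboolT// qT.
pose Qm : {measure set X -> \bar R} :=
  HB.pack Qf (isMeasure.Build _ _ _ Qf Q0 Qge Qs).
pose Q : probability X R :=
  HB.pack Qf (Measure.on Qm) (Measure_isProbability.Build _ _ _ Qm QT).
exists Q; split => A mA.
  by rewrite /= /Qf asboolT// lee_fin; have /andP[] := qV _ mA.
rewrite /= /Qf !asboolT// ?qI//; exact: (measurable_preimage_iter 1).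
Qed.

End InvariantCore.

(** * Birkhoff's theorem for ergodic probabilities *)

Section Birkhoff.
Context {d : measure_display} {X : measurableType d} {R : realType}.
Context {T : X -> X} (mT : measurable_fun setT T) (Q : probability X R).

Lemma integrable_bounded (f : X -> R) (K : R) : measurable_fun setT f ->
  (forall x, `|f x| <= K) -> Q.-integrable setT (EFin \o f).
Proof.
move=> mf fK; apply: le_integrable (finite_measure_integrable_cst Q K measurableT) => //.
  exact/measurable_EFinP.
by move=> x _ /=; rewrite lee_fin (le_trans (fK x))// ler_norm.
Qed.

Definition birkhoff_sum (h : X -> R) n x := \sum_(i < n) h (iter i T x).

Lemma birkhoff_sumS h n x :
  birkhoff_sum h n.+1 x = h x + birkhoff_sum h n (T x).
Proof.
rewrite /birkhoff_sum big_ord_recl /=; congr (_ + _).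
by apply: eq_bigr => i _; rewrite -iterSr.
Qed.

Lemma measurable_birkhoff_sum h n : measurable_fun setT h ->
  measurable_fun setT (birkhoff_sum h n).
Proof.
move=> mh; apply: measurable_sum => i.
exact: (measurableT_comp mh (measurable_iter mT i)).
Qed.

(** For bounded [h] this event is exactly invariant, not just up to a null set, so ergodicity
    applies to it and [V] can be compared with [Q] on it. *)
Definition unbounded_sums (h : X -> R) : set X :=
  [set x | forall k : nat, exists n, k%:R < birkhoff_sum h n x].

(** Passing from [x] to [T x] changes the sums by [h x] only, which raising the threshold by
    [Num.bound K] absorbs. *)
Lemma unbounded_sums_invariant (h : X -> R) (K : R) : measurable_fun setT h ->
  (forall x, `|h x| <= K) -> invariant_set T (unbounded_sums h).
Proof.
move=> mh hK; split.
  rewrite (_ : unbounded_sums h = \bigcap_k \bigcup_n [set x | k%:R < birkhoff_sum h n x]).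
    apply: bigcap_measurable; first by exists 0%N.
    move=> k _; apply: bigcup_measurable => n _.
    rewrite -[X in measurable X]setTI -preimage_itvoy.
    exact: measurable_birkhoff_sum.
  apply/seteqP; split => x /=.
    by move=> h1 k _; have [n hn] := h1 k; exists n.
  by move=> h1 k; have [n _ hn] := h1 k I; exists n.
have K0 : 0 <= K by exact: le_trans (hK point).
have bK : K < (Num.bound K)%:R by exact: archi_boundP.
apply/seteqP; split => x /= hx k.
  have [n hn] := hx (k + Num.bound K)%N; exists n.+1; rewrite birkhoff_sumS.
  by move: hn (hK x); rewrite natrD ler_norml; lra.
have [[|n]] := hx (k + Num.bound K)%N.
  by rewrite /birkhoff_sum big_ord0 ltNge ler0n.
rewrite birkhoff_sumS natrD => hn; exists n.
by move: hn (hK x); rewrite ler_norml; lra.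
Qed.

(* [max_sum h n] is the maximum of the Birkhoff sums of orders 1 to n + 1. *)
Fixpoint max_sum (h : X -> R) n : X -> R :=
  if n is m.+1 then fun x => h x + Num.max 0 (max_sum h m (T x)) else h.

Lemma max_sum_leS h n x : max_sum h n x <= max_sum h n.+1 x.
Proof.
elim: n x => [|n IH] x /=; first by rewrite lerDl le_max lexx.
by rewrite lerD2l ge_max !le_max lexx /= (IH (T x)) orbT.
Qed.

Lemma max_sum_ge h n x : h x <= max_sum h n x.
Proof. by case: n => [|n] //=; rewrite lerDl le_max lexx. Qed.

Lemma birkhoff_sum_le_max h n m x : (n <= m)%N ->
  birkhoff_sum h n.+1 x <= max_sum h m x.
Proof.
elim: n m x => [|n IH] m x nm.
  by rewrite birkhoff_sumS /birkhoff_sum big_ord0 addr0 max_sum_ge.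
case: m nm => // m nm; rewrite birkhoff_sumS /= lerD2l le_max.
by rewrite IH ?orbT.
Qed.

Lemma measurable_max_sum h n : measurable_fun setT h ->
  measurable_fun setT (max_sum h n).
Proof.
move=> mh; elim: n => [//|n IH] /=; apply: measurable_funD => //.
apply: measurable_maxr => //.
exact: measurableT_comp.
Qed.

Lemma max_sum_bounded h n K : (forall x, `|h x| <= K) ->
  forall x, `|max_sum h n x| <= n.+1%:R * K.
Proof.
move=> hK; elim: n => [|n IH] x /=; first by rewrite mul1r.
have := IH (T x); have := hK x; rewrite -[n.+2]addn1 natrD mulrDl mul1r.
by rewrite !ler_norml; case: (leP 0 (max_sum h n (T x))); lra.
Qed.

Context (QT : ergodic_prob T Q).

(** The pushforward of [Q] under [T] is [Q] itself. *)
Lemma Rintegral_invariant (f : X -> R) (K : R) : measurable_fun setT f ->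
  (forall x, `|f x| <= K) -> \int[Q]_x f (T x) = \int[Q]_x f x.
Proof.
move=> mf fK; rewrite /Rintegral; congr fine.
have mfT : measurable_fun setT (fun x => f (T x)) by exact: measurableT_comp.
have ifT := integrable_bounded mfT (fun x => fK (T x)).
have := @integral_pushforward _ _ _ _ _ T mT Q setT (EFin \o f) _ _ measurableT.
rewrite preimage_setT => <- //; last exact/measurable_EFinP.
apply: (@eq_measure_integral _ _ _ _ Q
  (measure_function_pushforward__canonical__measure_function_Measure Q mT)) => A mA _.
exact: QT.1.
Qed.

(* If the sums are unbounded almost everywhere then, M_n being the running
   maximum, M_{n+1} - M_n o T = h + (M_n o T)^- decreases to h, while its
   integral is that of M_{n+1} - M_n, hence nonnegative. *)
Lemma unbounded_sums_null (h : X -> R) (K : R) : measurable_fun setT h ->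
  (forall x, `|h x| <= K) -> \int[Q]_x h x < 0 -> Q (unbounded_sums h) = 0%E.
Proof.
move=> mh hK h0; have iB := unbounded_sums_invariant mh hK.
have [//|Q1] := QT.2 _ iB; exfalso; case: iB => mB TB.
have K0 : 0 <= K by exact: le_trans (hK point).
(* [r n] is the negative part of [max_sum h n] composed with [T]; it is at most [K] because
   [max_sum h n] is at least [h]. *)
pose r n x := Num.max 0 (- max_sum h n (T x)).
have mMT n : measurable_fun setT (fun x => max_sum h n (T x)).
  exact: measurableT_comp (measurable_max_sum n mh) mT.
have mr n : measurable_fun setT (r n).
  rewrite /r; apply: measurable_maxr => //.
  exact: measurableT_comp.
have rK n x : `|r n x| <= K.
  have := max_sum_ge h n (T x); have := hK (T x).
  by rewrite /r !ler_norml; case: (leP 0 (- max_sum h n (T x))); lra.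
have rE n x : max_sum h n.+1 x - max_sum h n (T x) = h x + r n x.
  rewrite /= /r; set M := max_sum h n (T x).
  by case: (leP 0 M) => ?; case: (leP 0 (- M)) => ?; lra.
have iM n := integrable_bounded (measurable_max_sum n mh) (max_sum_bounded n hK).
have iMT n := integrable_bounded (mMT n) (fun x => max_sum_bounded n hK (T x)).
have ih := integrable_bounded mh hK.
have ir n := integrable_bounded (mr n) (rK n).
have ge0 n : 0 <= \int[Q]_x h x + \int[Q]_x r n x.
  rewrite -RintegralD//.
  rewrite (_ : \int[Q]_x _ = \int[Q]_x (max_sum h n.+1 x - max_sum h n (T x))).
    rewrite RintegralB// (Rintegral_invariant (measurable_max_sum n mh) (max_sum_bounded n hK)).
    by rewrite subr_ge0; apply: le_Rintegral => // x _; exact: max_sum_leS.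
  by apply: eq_Rintegral => x _; rewrite rE.
have r0 : (\int[Q]_x (r n x)%:E)%E @[n --> \oo] --> (\int[Q]_x (0%R)%:E)%E.
  have [|||||_ _] := @dominated_convergence _ _ _ Q setT measurableT
    (fun n x => (r n x)%:E) (fun=> (0%R)%:E) (fun=> K%:E).
  - by move=> n; exact/measurable_EFinP.
  - by [].
  - exists (~` unbounded_sums h); split.
    + exact: measurableC.
    + by have := probability_setC Q mB; rewrite Q1 subee.
    (* By invariance [T x] also has unbounded sums. One of them, necessarily of positive order,
       exceeds 0, so the later maxima at [T x] are positive and [r m x] vanishes. *)
    + apply: subsetC => x; rewrite -TB => /= Bx _.
      have [n] := Bx 0%N; case: n => [|n]; first by rewrite /birkhoff_sum big_ord0 ltxx.
      move=> hn; apply: cvg_near_cst; exists n => // m /= nm.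
      congr (_%:E); rewrite /r; apply/max_idPl.
      by rewrite oppr_le0 (le_trans (ltW hn))// birkhoff_sum_le_max.
  - exact: finite_measure_integrable_cst.
  - by apply: aeW => x n _; rewrite lee_fin.
  - exact.
rewrite integral0 in r0.
have : \int[Q]_x r n x @[n --> \oo] --> (0 : R) by exact: fine_cvg r0.
move=> /cvgrPdist_lt /(_ (- \int[Q]_x h x)); rewrite oppr_gt0 => /(_ h0) [n _ /(_ n)].
by rewrite /= leqnn => /(_ isT); rewrite sub0r normrN ltr_norml; have := ge0 n; lra.
Qed.

(** The function [g - c] has negative integral, so its sums are bounded above off an invariant null
    set. *)
Lemma birkhoff_upper (g : X -> R) (K c : R) : measurable_fun setT g ->
  (forall x, `|g x| <= K) -> \int[Q]_x g x < c ->
  exists N, [/\ invariant_set T N, Q N = 0%E & forall x, ~ N x ->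
    exists k : nat, forall n, birkhoff_sum g n x <= k%:R + n%:R * c].
Proof.
move=> mg gK gc; pose h x := g x - c.
have mh : measurable_fun setT h by exact: measurable_funB.
have hK x : `|h x| <= K + `|c|.
  by rewrite (le_trans (ler_normB _ _))// lerD2r.
have h0 : \int[Q]_x h x < 0.
  rewrite RintegralB//; last 2 first.
    - exact: integrable_bounded gK.
    - exact: finite_measure_integrable_cst.
  rewrite Rintegral_cst// -[X in _ * X]/(fine (Q setT)) probability_setT.
  by rewrite mulr1 subr_lt0.
exists (unbounded_sums h); split.
- exact: unbounded_sums_invariant hK.
- exact: unbounded_sums_null hK h0.
- move=> x /existsNP[k hk]; exists k => n; rewrite leNgt; apply/negP => kn.
  apply: hk; exists n; rewrite /birkhoff_sum sumrB sumr_const card_ord.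
  by rewrite -[c *+ n]mulr_natl ltrBrDr.
Qed.

Lemma invariant_null_bigcup (N : nat -> set X) :
  (forall k, invariant_set T (N k) /\ Q (N k) = 0%E) ->
  invariant_set T (\bigcup_k N k) /\ Q (\bigcup_k N k) = 0%E.
Proof.
move=> hN; have mU : measurable (\bigcup_k N k).
  by apply: bigcupT_measurable => k; have [[]] := hN k.
split; first split => //.
- by rewrite preimage_bigcup; apply: eq_bigcupr => // k _; have [[]] := hN k.
- apply: measure_negligible => //; apply: negligible_bigcup => k.
  by have [[mk _] N0] := hN k; exists (N k); split.
Qed.

(** The one-sided bound is applied to [g] and [- g] with margins [1 / (k + 1)]. The countable union
    of the exceptional sets stays invariant and null. *)
Lemma birkhoff_ergodic (g : X -> R) (K : R) : measurable_fun setT g ->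
  (forall x, `|g x| <= K) ->
  exists N, [/\ invariant_set T N, Q N = 0%E & forall x, ~ N x ->
    n%:R^-1 * birkhoff_sum g n x @[n --> \oo] --> \int[Q]_x g x].
Proof.
move=> mg gK; set c := \int[Q]_x g x.
have ig := integrable_bounded mg gK.
have mNg : measurable_fun setT (fun x => - g x) by exact: measurableT_comp.
have NgK x : `|- g x| <= K by rewrite normrN.
have cN : \int[Q]_x (- g x) = - c.
  under eq_Rintegral do rewrite -mulN1r.
  by rewrite RintegralZl// mulN1r.
pose e k : R := k.+1%:R^-1.
have e0 k : 0 < e k by rewrite invr_gt0.
have /choice[N1 hN1] k := birkhoff_upper mg gK (c := c + e k) (ltr_pwDr (e0 k) (lexx c)).
have /choice[N2 hN2] k : exists N, [/\ invariant_set T N, Q N = 0%E & forall x, ~ N x ->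
    exists m : nat, forall n, birkhoff_sum (fun x => - g x) n x <= m%:R + n%:R * (- c + e k)].
  by apply: birkhoff_upper NgK _ => //; rewrite cN ltr_pwDr.
have [|i1 q1] := @invariant_null_bigcup N1; first by move=> k; have [] := hN1 k.
have [|i2 q2] := @invariant_null_bigcup N2; first by move=> k; have [] := hN2 k.
exists (\bigcup_k N1 k `|` \bigcup_k N2 k); split.
- by split; [exact: measurableU i1.1 i2.1|rewrite preimage_setU i1.2 i2.2].
- by apply: null_set_setU => //; [exact: i1.1|exact: i2.1].
move=> x /not_orP[n1 n2]; apply/cvgrPdist_lt => a a0.
pose k := Num.bound (2 / a).
have eka : e k < a / 2.
  have a20 : 0 < 2 / a by rewrite divr_gt0.
  rewrite /e -[a / 2]invrK ltf_pV2 ?posrE ?invr_gt0 ?divr_gt0// invf_div.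
  by rewrite (lt_trans (archi_boundP (ltW a20)))// ltr_nat.
have [_ _ /(_ x)] := hN1 k; case=> [|m1 h1]; first by move=> ?; apply: n1; exists k.
have [_ _ /(_ x)] := hN2 k; case=> [|m2 h2]; first by move=> ?; apply: n2; exists k.
(* Beyond this rank the additive constants, divided by [n], contribute less than [a / 2]; the margin
   [e k] accounts for the other half. *)
exists (Num.bound ((m1 + m2)%:R / (a / 2))).+1 => // n /= hn.
have n0 : 0 < n%:R :> R by rewrite ltr0n; lia.
have mn : m1%:R + m2%:R < n%:R * (a / 2) :> R.
  rewrite -natrD -ltr_pdivrMr ?divr_gt0//.
  apply: (lt_le_trans (archi_boundP _)); last by rewrite ler_nat ltnW.
  by rewrite divr_ge0// ltW// divr_gt0.
rewrite distrC.
have -> : n%:R^-1 * birkhoff_sum g n x - c = n%:R^-1 * (birkhoff_sum g n x - n%:R * c).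
  by rewrite mulrBr mulKf ?gt_eqF.
rewrite normrM gtr0_norm ?invr_gt0// ltr_pdivrMl//.
have := h1 n; have := h2 n; rewrite /birkhoff_sum sumrN -/(birkhoff_sum g n x).
have ne : n%:R * e k < n%:R * (a / 2) by rewrite ltr_pM2l.
have m10 : 0 <= m1%:R :> R by []. have m20 : 0 <= m2%:R :> R by [].
rewrite !mulrDr ltr_norml mulrN; lra.
Qed.

End Birkhoff.

(** * Ergodic upper probabilities *)

Section ErgodicUpperProbability.
Context {d : measure_display} {X : measurableType d} {R : realType}.
Context {T : X -> X} (mT : measurable_fun setT T).
Context {V : set X -> R} (hV : upper_probability V).

Lemma avgE (f g : X -> R) n x :
  avg T f g n x = f x * (n%:R^-1 * birkhoff_sum (T := T) g n x).
Proof. by rewrite /avg -mulr_sumr mulrCA. Qed.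

Lemma measurable_avg (f g : X -> R) n : measurable_fun setT f ->
  measurable_fun setT g -> measurable_fun setT (avg T f g n).
Proof.
move=> mf mg; rewrite (_ : avg T f g n =
  (fun x => f x * (n%:R^-1 * birkhoff_sum (T := T) g n x))); last exact/funext/avgE.
apply: measurable_funM => //; apply: measurable_funM => //.
exact: measurable_birkhoff_sum.
Qed.

Lemma avg_bounded (f g : X -> R) (K L : R) n x : (forall x, `|f x| <= K) ->
  (forall x, `|g x| <= L) -> `|avg T f g n x| <= K * L.
Proof.
move=> fK gL; rewrite avgE normrM; apply: ler_pM => //.
have L0 : 0 <= L by exact: le_trans (gL x).
case: n => [|n]; first by rewrite /birkhoff_sum big_ord0 mulr0 normr0.
rewrite normrM normfV normr_nat ler_pdivrMl//.
rewrite (le_trans (ler_norm_sum _ _ _))//.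
rewrite (le_trans (ler_sum _ (fun i _ => gL _)))//.
by rewrite sumr_const card_ord -[L *+ _]mulr_natl.
Qed.

(** Off an invariant [Q]-null, hence [V]-null, set the averages tend to [f] times the integral of
    [g]. As [g >= 0], this constant is nonnegative and leaves the Choquet integral by positive
    homogeneity. *)
Lemma choquet_avg_cvg (Q : probability X R) (f g : X -> R) :
  ergodic_prob T Q -> (forall A, invariant_set T A -> (V A)%:E = Q A) ->
  bounded_measurable f -> bounded_measurable g -> (forall x, 0 <= g x) ->
  choquet V (avg T f g n) @[n --> \oo] --> (choquet V f * \int[Q]_x (g x)%:E)%E.
Proof.
move=> eQ VQ [mf [K fK]] [mg [L gL]] g0.
have [N [iN QN cN]] := birkhoff_ergodic mT eQ mg gL.
set c := \int[Q]_x g x in cN *.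
have c0 : 0 <= c by exact: Rintegral_ge0.
have -> : (\int[Q]_x (g x)%:E)%E = c%:E.
  by rewrite /c /Rintegral fineK// integrable_fin_num//; exact: integrable_bounded gL.
rewrite -(choquetZ hV mf fK c0).
have VN : V N = 0 by apply/eqP; rewrite -eqe VQ// QN.
(* The bound is a sum so as to dominate both the averages, by [K * L], and their limit, by
   [K * c]. *)
apply: (choquet_cvg hV (N := N) (K := K * L + K * c)) => //.
- by move=> n; exact: measurable_avg.
- exact: measurable_funM.
- move=> n x; rewrite (le_trans (avg_bounded _ _ fK gL))// lerDl mulr_ge0//.
  exact: le_trans (fK x).
- move=> x; rewrite normrM (ger0_norm c0).
  have K0 : 0 <= K by exact: le_trans (fK x).
  have L0 : 0 <= L by exact: le_trans (gL x).
  by rewrite (@le_trans _ _ (K * c)) ?ler_wpM2r// lerDr mulr_ge0.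
- exact: iN.1.
- move=> x Nx; under eq_cvg do rewrite avgE.
  by apply: cvgM; [exact: cvg_cst|exact: cN].
Qed.

Lemma bounded_measurable_indic (B : set X) : measurable B ->
  bounded_measurable (\1_B : X -> R).
Proof.
move=> mB; split => //; exists 1 => x.
by rewrite indicE normr_nat; case: (_ \in _).
Qed.

Lemma invariant_iter (A : set X) i x : T @^-1` A = A -> A (iter i T x) <-> A x.
Proof.
move=> TA; have TE y : A (T y) = A y by rewrite -[in RHS]TA.
by elim: i => [//|i IH] /=; rewrite TE.
Qed.

Lemma upper_probability_setC0 (A : set X) : measurable A -> V (~` A) = 0 -> V A = 1.
Proof.
move=> mA VC; apply/eqP; rewrite eq_le (upper_probability_le1 hV mA)/=.
have := upper_probability_setU hV mA (measurableC mA).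
by rewrite setUv VC addr0 (upper_probability_setT hV).
Qed.

End ErgodicUpperProbability.

(** * The cycle of implications between the four conditions *)

Unset Implicit Arguments.
Set Strict Implicit.

Theorem theorem4p3 (d : measure_display) (X : measurableType d) (R : realType)
    (T : X -> X) (V : set X -> R) :
  measurable_fun setT T ->
  upper_probability V ->
  T_invariant_cap T V ->
  [<-> ergodic_cap T V;
       exists Q : probability X R,
         [/\ in_core V Q, ergodic_prob T Q,
             (forall A, invariant_set T A -> (V A)%:E = Q A) &
             (forall f g : X -> R, bounded_measurable f -> bounded_measurable g ->
                (forall x, 0 <= g x) ->
                (fun n => choquet V (avg T f g n)) @ \oo -->
                  (choquet V f * \int[Q]_x (g x)%:E)%E)];
       exists Q : probability X R,
         [/\ in_core V Q, invariant_prob T Q &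
             (forall B C, measurable B -> measurable C ->
                (fun n => choquet V (avg T (\1_B) (\1_C) n)) @ \oo -->
                  ((V B)%:E * Q C)%E)];
       exists Q : probability X R,
         (forall A, invariant_set T A -> Q A = 0%E -> V A = 0) /\
         (forall B C, measurable B -> measurable C ->
            ((V B)%:E * Q C <=
               limn_einf (fun n => choquet V (avg T (\1_B) (\1_C) n)))%E)].
Proof.
move=> mT hV hT; tfae.
- move=> eV; have [Q [cQ iQ]] := exists_invariant_core hV mT hT.
  (* If [V A] is 0 then so is [Q A]; otherwise [V], hence [Q], vanishes on the complement and both
     are 1 at [A]. *)
  have VQ A : invariant_set T A -> (V A)%:E = Q A.
    move=> iA; have mA := iA.1; have [_ [VA|VA]] := eV _ iA.
      by apply/eqP; rewrite VA eq_le measure_ge0/= -VA cQ.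
    rewrite (upper_probability_setC0 hV mA VA).
    have : Q (~` A) = 0%E.
      apply/eqP; rewrite eq_le measure_ge0 andbT.
      by have := cQ _ (measurableC mA); rewrite VA.
    have := probability_setC Q (measurableC mA).
    by rewrite setCK => -> ->; rewrite sube0.
  have eQ : ergodic_prob T Q.
    split => // A iA; rewrite -VQ//.
    by have [[->|->] _] := eV _ iA; [left|right].
  by exists Q; split => // f g; exact: choquet_avg_cvg.
- move=> [Q [cQ [iQ eQ] VQ h]]; exists Q; split => // B C mB mC.
  have := h _ _ (bounded_measurable_indic mB) (bounded_measurable_indic mC) _.
  rewrite choquet_indic// integral_indic// setIT; apply => x.
  by rewrite indicE.
- move=> [Q [cQ iQ h]]; exists Q; split => [A [mA TA] QA|B C mB mC]; last first.
    by have [->] := cvg_limn_einf_sup (h _ _ mB mC).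
  (* With [B = C = A] the averages equal the indicator of [A] for [n >= 1], so the limit is both
     [V A] and [V A * Q A = 0]. *)
  have := h _ _ mA mA; rewrite QA mule0 => c0.
  have c1 : choquet V (avg T \1_A \1_A n) @[n --> \oo] --> (V A)%:E.
    rewrite -(choquet_indic hV mA); apply: cvg_near_cst; exists 1%N => // n /= n1.
    congr choquet; apply/funext => x; rewrite avgE /birkhoff_sum.
    have [xA|xA] := pselect (A x); last by rewrite indicE memNset// mul0r.
    under eq_bigr do rewrite indicE mem_set ?invariant_iter//.
    by rewrite sumr_const card_ord mulVf ?mulr1// pnatr_eq0 -lt0n.
  apply: (@EFin_inj R); rewrite -(cvg_lim (@ereal_hausdorff R) c1).
  exact: (cvg_lim (@ereal_hausdorff R) c0).
- move=> [Q [QV h]] A [mA TA]; have mCA := measurableC mA.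
  have iCA : invariant_set T (~` A) by split => //; rewrite -[in RHS]TA.
  have := h _ _ mA mCA.
  have -> : limn_einf (fun n => choquet V (avg T \1_A \1_(~` A) n)) = 0%E.
    have -> : (fun n => choquet V (avg T \1_A \1_(~` A) n)) = fun=> 0%E.
      apply/funext => n; have := choquet_indic hV measurable0.
      rewrite (upper_probability_set0 hV) => E0; rewrite -[RHS]E0; congr choquet.
      apply/funext => x; rewrite avgE indic0 /birkhoff_sum.
      have [xA|xA] := pselect (A x); last by rewrite indicE memNset// mul0r.
      rewrite big1 ?mulr0// => i _; rewrite indicE memNset//=.
      by apply; rewrite invariant_iter.
    by have [->] := cvg_limn_einf_sup (cvg_cst (0%E : \bar R)).
  move=> h0; have VA0 := upper_probability_ge0 hV mA.
  have : V A = 0 \/ V (~` A) = 0.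
    have [|VA] := eqVneq (V A) 0; [by left|right].
    (* Since [V A > 0], the inequality forces [Q], and then [V], to vanish on the complement. *)
    apply: QV => //; apply/eqP; rewrite eq_le measure_ge0 andbT.
    by rewrite -(@lee_pmul2l _ (V A)%:E) ?mule0// lte_fin lt_neqAle eq_sym VA.
  case=> VA; split; [by left|by left| |by right].
  by right; exact: upper_probability_setC0.
Qed.
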